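(* Given a vector $(p,r)\in\mathbb{Z}^2$ with $p\ge 0$ and $r\ge 2$, there exists a bipartite graph $G$ such that $\mathrm{pdim}(I_G)=p$ and $\mathrm{reg}(I_G)=r$.
   Context: $\mathbb{K}$ is a field. For a finite simple graph $G$ with edge set $E$, the toric ideal $I_G$ is the kernel of the $\mathbb{K}$-algebra map from the standard graded polynomial ring $\mathbb{K}[E]$ (variables indexed by edges) to the polynomial ring over $\mathbb{K}$ on the vertices of $G$, sending an edge $\{a,b\}$ to $ab$. For a finitely generated graded $\mathbb{K}[E]$-module $M$ with $\beta_{i,j}(M)=\dim_{\mathbb{K}}\mathrm{Tor}_i^{\mathbb{K}[E]}(M,\mathbb{K})_j$, $\mathrm{reg}(M)=\max\{j-i:\beta_{i,j}(M)\ne0\}$ and $\mathrm{pdim}(M)=\max\{i:\beta_{i,j}(M)\ne0\text{ for some }j\}$. *)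

(* Defs.v *)
From HB Require Import structures.
From mathcomp Require Import all_boot all_order all_algebra.
From mathcomp Require Import mpoly.

Set Implicit Arguments.
Unset Strict Implicit.
Unset Printing Implicit Defensive.

Import Order.TTheory GRing.Theory Num.Theory.
Local Open Scope ring_scope.

Record sgraph := SGraph {
  vertex :> finType;
  adj : rel vertex;
  adj_sym : ssrbool.symmetric adj;
  adj_irrefl : irreflexive adj
}.

Definition edges (G : sgraph) : {set {set G}} :=
  [set A : {set G} | [exists x : G, exists y : G, adj x y && (A == [set x; y])]].

Definition bipartite (G : sgraph) : Prop :=
  exists A : {set G}, forall x y : G, adj x y -> (x \in A) != (y \in A).

(* K[E] is {mpoly K[#|edges G|]}, the i-th variable standing for the edge
   enum_val i; the ring on the vertices is {mpoly K[#|G|]}, the variable of v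
   having index enum_rank v. *)
Definition edge_monomial (K : fieldType) (G : sgraph) (i : 'I_#|edges G|) :
    {mpoly K[#|G|]} :=
  \prod_(v in enum_val i) 'X_(enum_rank v).

Definition toric_map (K : fieldType) (G : sgraph)
    (f : {mpoly K[#|edges G|]}) : {mpoly K[#|G|]} :=
  f \mPo [tuple edge_monomial K i | i < #|edges G|].

Definition toric_ideal (K : fieldType) (G : sgraph)
    (f : {mpoly K[#|edges G|]}) : Prop :=
  toric_map f = 0.

(* Homogeneity in an integer degree: S_d = 0 for d < 0.  Integer degrees are
   needed for the twists of a (not necessarily minimal) free resolution. *)
Definition homog_of_deg (K : fieldType) (n : nat) (d : int)
    (f : {mpoly K[n]}) : Prop :=
  match d with
  | Posz m => f \is m.-homog
  | Negz _ => f = 0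
  end.

(* Data of a complex ... -> F_1 -> F_0 -> S of finitely generated graded free
   modules over S = {mpoly K[n]}: F_i = 'rV[S]_(rk i), its k-th basis vector has
   degree twist i k (so F_i is the sum of the S(- twist i k)), and the maps are
   right multiplication by the matrices diff i : F_(i+1) -> F_i and
   augm : F_0 -> S. *)
Record free_complex (K : fieldType) (n : nat) := FreeComplex {
  rk : nat -> nat;
  twist : forall i, 'I_(rk i) -> int;
  augm : 'cV[{mpoly K[n]}]_(rk 0);
  diff : forall i, 'M[{mpoly K[n]}]_(rk i.+1, rk i)
}.

(* F is a graded free resolution of the ideal M of S (a graded submodule of S):
   all maps have degree 0, the image of F_0 -> S is M, and
   ... -> F_1 -> F_0 -> M is exact. *)
Record free_resolution (K : fieldType) (n : nat) (M : {mpoly K[n]} -> Prop)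
    (F : free_complex K n) : Prop := {
  augm_homog : forall k, homog_of_deg (twist k) (augm F k 0);
  diff_homog : forall i k l,
    homog_of_deg (twist k - twist l) (diff F i k l);
  augm_image : forall f,
    M f <-> exists v : 'rV[{mpoly K[n]}]_(rk F 0), f = (v *m augm F) 0 0;
  exact_0 : forall v : 'rV[{mpoly K[n]}]_(rk F 0),
    v *m augm F = 0 <-> exists w : 'rV[{mpoly K[n]}]_(rk F 1), v = w *m diff F 0;
  exact_S : forall i (v : 'rV[{mpoly K[n]}]_(rk F i.+1)),
    v *m diff F i = 0 <->
    exists w : 'rV[{mpoly K[n]}]_(rk F i.+2), v = w *m diff F i.+1
}.

Section Tor.
Variables (K : fieldType) (n : nat) (F : free_complex K n).

(* F_i (x)_S K = 'rV[K]_(rk F i), where K = S / (variables): the differentials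
   are obtained by taking constant terms. *)
Definition diffK (i : nat) : 'M[K]_(rk F i.+1, rk F i) :=
  map_mx (mcoeff 0%MM) (diff F i).

Definition cyclesK (i : nat) : 'M[K]_(rk F i) :=
  match i with
  | 0 => 1%:M
  | i'.+1 => kermx (diffK i')
  end.

(* Its row space is the degree j component of F_i (x)_S K. *)
Definition degK (i : nat) (j : int) : 'M[K]_(rk F i) :=
  diag_mx (\row_k (twist k == j)%:R).

(* dim_K of the degree j component of H_i (F (x)_S K). *)
Definition tor_dim (i : nat) (j : int) : nat :=
  (\rank (cyclesK i :&: degK i j)%MS - \rank (diffK i :&: degK i j)%MS)%N.

End Tor.

(* b i j = dim_K Tor_i^S(M, K)_j.  Tor is computed from a graded free resolution
   of M; as it does not depend on the resolution, b is determined by M. *)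
Definition graded_betti (K : fieldType) (n : nat) (M : {mpoly K[n]} -> Prop)
    (b : nat -> int -> nat) : Prop :=
  exists F : free_complex K n,
    free_resolution M F /\ forall i j, b i j = tor_dim F i j.

Definition is_max (A : int -> Prop) (m : int) : Prop :=
  A m /\ forall x, A x -> x <= m.

Definition is_pdim (K : fieldType) (n : nat) (M : {mpoly K[n]} -> Prop)
    (p : int) : Prop :=
  exists b, graded_betti M b /\
    is_max (fun x => exists i j, b i j <> 0%N /\ x = i%:Z) p.

Definition is_reg (K : fieldType) (n : nat) (M : {mpoly K[n]} -> Prop)
    (r : int) : Prop :=
  exists b, graded_betti M b /\
    is_max (fun x => exists i j, b i j <> 0%N /\ x = j - i%:Z) r.

(* Main.v *)
From HB Require Import structures.
Require Import Defs.
From mathcomp Require Import all_boot all_order all_algebra.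
From mathcomp Require Import mpoly.
From mathcomp Require Import ring zify.

Set Implicit Arguments.
Unset Strict Implicit.
Unset Printing Implicit Defensive.

Import Order.TTheory GRing.Theory Num.Theory.
Local Open Scope ring_scope.


(** The graph is a generalized theta graph: two hubs joined by [p + 1] paths of
    length 2 and one path of length [2 (r - 1)].  Pair up the edges along each
    path; the odd edges of the j-th path have a product [x_j] and the even ones
    a product [y_j].  The toric map sends [x_j] to [s T_j] and [y_j] to [t T_j],
    where [s], [t] are the hubs and [T_j] collects the inner vertices, so the
    2-minors [x_j y_l - x_l y_j] are in the toric ideal.  They generate it: two
    monomials with the same image differ by a circulation on the paths, and
    multiples of minors undo this circulation one unit at a time
    ([fiber_binomial], [theta_fiber]); the kernel of a monomial map is spanned
    by such differences of monomials ([monomial_map_ker]).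

    So the toric ideal is the ideal of maximal minors of a 2 x (p + 2) matrix
    whose entries are monomials in pairwise disjoint variables, and it is
    resolved by the Eagon-Northcott complex, of length [p].  The entries of the
    differentials are entries of the matrix, hence have no constant term, and
    the resolution is minimal ([tor_dim_minimal]).  Its i-th module has a
    generator of degree the sum of [deg x_j] over [J] for each subset [J] of
    [i + 2] columns (with multiplicity [i + 1]).  All columns have degree 1
    except the last one, of degree [r - 1], so this degree minus [i] is at most
    [r], with equality for the full set of columns, at [i = p] ([en_pdim_reg]).

    Exactness is proved by induction on the number of columns
    ([eagon_northcott_exact]).  Write [L^m] for the m-th exterior power of the
    free module on the columns, and [ix], [iy] for the contractions of [L^m]
    into [L^(m-1)] by the two rows.  An element of the i-th module is a sequence
    [w_0, ..., w_i] in [L^(i+2)], and the differential is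
    [(D w)_a = w_(a+1) ix + w_a iy].  The elements that do not involve the last
    column form the complex of the smaller matrix.  The quotient by them is
    filtered, through the term [w_0], by the truncated Koszul complex of the
    [y_j] and a shifted copy of the complex of the smaller matrix.  Exactness of
    these pieces lifts to the whole complex, provided that in homological degree
    0, modulo the ideal [I] of the smaller matrix, a combination
    [sum_j v_j (x_j y_k - x_k y_j)] vanishes only if [sum_j v_j y_j] does
    ([colon_cond]).  This holds because [I] is the kernel of the map to a domain
    sending [x_j] to [z y_j] ([straighten_colon]): it turns the combination into
    [(z y_k - x_k) sum_j v_j y_j]. *)

(** * Contractions of the exterior powers of a free module *)

(** The rank ['C(k, i)] of the i-th exterior power of a free module of rank [k].
    Unlike in [binomial], both [extrk 0 k = 1] and Pascal's rule hold by
    conversion, so that block matrices need no casts. *)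
Fixpoint extrk (i : nat) : nat -> nat :=
  match i with
  | 0 => fun=> 1%N
  | i'.+1 => fix extrk_i k :=
      match k with 0 => 0%N | k'.+1 => (extrk_i k' + extrk i' k')%N end
  end.

(** Contraction of the (i+1)-st exterior power of [R^k] by the linear form
    [c_0, ..., c_(k-1)], acting on row vectors.  A row [(a, b)] of rank
    [extrk i.+1 k + extrk i k] stands for [a + e /\ b] with [e] the last basis
    vector.  Putting [e] in front gives [e /\ b |-> c_k b - e /\ (contraction
    of b)], with no sign depending on the degree. *)
Fixpoint contr (R : comNzRingType) (c : nat -> R) (k i : nat) {struct k} :
    'M[R]_(extrk i.+1 k, extrk i k) :=
  match k return 'M[R]_(extrk i.+1 k, extrk i k) with
  | 0 => 0
  | k'.+1 =>
    match i return 'M[R]_(extrk i.+1 k'.+1, extrk i k'.+1) with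
    | 0 => col_mx (contr c k' 0) (c k')%:M
    | i'.+1 => block_mx (contr c k' i'.+1) 0 (c k')%:M (- contr c k' i')
    end
  end.

Section Contraction.
Variable R : comNzRingType.
Implicit Types (c x y : nat -> R).

Lemma contrS0 c k : contr c k.+1 0 = col_mx (contr c k 0) (c k)%:M.
Proof. by []. Qed.

Lemma contrSS c k i : contr c k.+1 i.+1 =
  block_mx (contr c k i.+1) 0 (c k)%:M (- contr c k i).
Proof. by []. Qed.

Lemma contr_last0 c k (a : 'rV_(extrk 1 k)) (b : 'rV_1) :
  (row_mx a b : 'rV_(extrk 1 k.+1)) *m contr c k.+1 0
    = a *m contr c k 0 + c k *: b.
Proof. by rewrite [LHS]mul_row_col mul_mx_scalar. Qed.

Lemma contr_last c k i (a : 'rV_(extrk i.+2 k)) (b : 'rV_(extrk i.+1 k)) :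
  (row_mx a b : 'rV_(extrk i.+2 k.+1)) *m contr c k.+1 i.+1
    = row_mx (a *m contr c k i.+1 + c k *: b) (- (b *m contr c k i)).
Proof.
by rewrite [LHS]mul_row_block mulmx0 add0r mul_mx_scalar mulmxN.
Qed.

Lemma contr_sq c k i : contr c k i.+1 *m contr c k i = 0.
Proof.
elim: k i => [|k IHk] [|i]; try exact: mul0mx.
  rewrite contrS0 contrSS [LHS]mul_block_col (IHk 0) mul0mx addr0.
  by rewrite mul_scalar_mx mul_mx_scalar scalerN subrr; exact: col_mx0.
rewrite !contrSS [LHS]mulmx_block !mul0mx !mulmx0 !mulNmx !mulmxN.
rewrite (IHk i) (IHk i.+1).
rewrite mul_scalar_mx mul_mx_scalar !(addr0, add0r, oppr0) subrr.
exact: block_mx0.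
Qed.

Lemma contr_anti x y k i :
  contr x k i.+1 *m contr y k i = - (contr y k i.+1 *m contr x k i).
Proof.
elim: k i => [|k IHk] [|i]; try by rewrite /= !mul0mx oppr0.
  rewrite !contrS0 !contrSS [LHS]mul_block_col [in RHS]mul_block_col !mul0mx.
  rewrite !addr0 !mul_scalar_mx !mul_mx_scalar (IHk 0) !scalerN.
  by rewrite [RHS]opp_col_mx opprB addrC.
rewrite !contrSS [LHS]mulmx_block [in RHS]mulmx_block !mul0mx !mulmx0.
rewrite !mulNmx !mulmxN !mul_scalar_mx !mul_mx_scalar (IHk i) (IHk i.+1).
rewrite [RHS]opp_block_mx !(addr0, add0r, oppr0) !opprK; congr block_mx.
by rewrite opprB addrC.
Qed.

Lemma contr_scale (s : R) c k i :
  contr (fun j => s * c j) k i = s *: contr c k i.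
Proof.
elim: k i => [|k IHk] [|i]; try by rewrite /= scaler0.
  by rewrite [LHS]/= IHk -scale_scalar_mx [RHS]scale_col_mx.
rewrite [LHS]/= !IHk -scale_scalar_mx -scalerN.
by rewrite [RHS]scale_block_mx scaler0.
Qed.

Lemma eq_contr c c' k i : (forall j, (j < k)%N -> c j = c' j) ->
  contr c k i = contr c' k i.
Proof.
elim: k i => [|k IHk] [|i] // cc'; rewrite ?contrS0 ?contrSS.
  by rewrite (IHk 0) ?cc' // => j jk; apply/cc'/ltnW.
by rewrite (IHk i) ?(IHk i.+1) ?cc' // => j jk; apply/cc'/ltnW.
Qed.

Lemma contr_eq0 c k i : (forall j, (j < k)%N -> c j = 0) -> contr c k i = 0.
Proof.
move=> c0; rewrite -[RHS](scale0r (contr c k i)) -contr_scale.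
by apply: eq_contr => j jk; rewrite c0 // mul0r.
Qed.

End Contraction.

Lemma map_contr (R S : comNzRingType) (f : {rmorphism R -> S}) (c : nat -> R)
    k i :
  map_mx f (contr c k i) = contr (f \o c) k i.
Proof.
elim: k i => [|k IHk] [|i]; try exact: map_mx0.
  by rewrite !contrS0 [LHS]map_col_mx (IHk 0) map_scalar_mx.
by rewrite !contrSS [LHS]map_block_mx map_scalar_mx map_mxN map_mx0
           (IHk i) (IHk i.+1).
Qed.

Section Minors.
Variable R : comNzRingType.
Implicit Types (c x y : nat -> R).

Lemma contr_basis k j : (j < k)%N ->
  exists e : 'rV[R]_(extrk 1 k), forall c, e *m contr c k 0 = (c j)%:M.
Proof.
elim: k => // k IHk; rewrite ltnS leq_eqVlt => /predU1P[->|/IHk[e eE]].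
  exists (row_mx 0 1%:M) => c.
  by rewrite contr_last0 mul0mx add0r scale_scalar_mx mulr1.
by exists (row_mx e 0) => c; rewrite contr_last0 eE scaler0 addr0.
Qed.

(** Encoded as the image of the augmentation of the Eagon-Northcott complex, the
    contraction by both rows. *)
Definition minors_ideal x y k (f : R) : Prop :=
  exists w : 'rV_(extrk 2 k), f%:M = w *m contr x k 1 *m contr y k 0.

Section MinorsIdeal.
Variables (x y : nat -> R) (k : nat).

Lemma minors_ideal0 : minors_ideal x y k 0.
Proof. by exists 0; rewrite !mul0mx raddf0. Qed.

Lemma minors_idealD f g :
  minors_ideal x y k f -> minors_ideal x y k g -> minors_ideal x y k (f + g).
Proof.
by move=> [v vE] [w wE]; exists (v + w); rewrite raddfD /= vE wE !mulmxDl.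
Qed.

Lemma minors_idealM f g : minors_ideal x y k f -> minors_ideal x y k (g * f).
Proof.
by move=> [v vE]; exists (g *: v); rewrite -!scalemxAl -vE scale_scalar_mx.
Qed.

End MinorsIdeal.

(** The contraction by [x] then [y] of [e_j /\ e_l] is, up to sign, the minor on
    the columns [j] and [l]. *)
Lemma minor_in_ideal x y k j l : (j < k)%N -> (l < k)%N ->
  minors_ideal x y k (x j * y l - x l * y j).
Proof.
wlog jl : j l / (j < l)%N => [IH jk lk|].
  have [jl|lj|->] := ltngtP j l; first exact: IH.
    by rewrite -opprB -mulN1r; apply/minors_idealM/IH.
  by rewrite mulrC subrr; apply: minors_ideal0.
elim: k => // k IHk _; rewrite ltnS leq_eqVlt => /predU1P[<-|lk].
  have [e eE] := contr_basis jl.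
  (* minus the wedge of the new basis vector with the j-th one *)
  exists (row_mx 0 (- e)); rewrite contr_last contr_last0.
  rewrite !mulNmx !mul0mx opprK add0r !scalerN !mulNmx !scalemxAl -!scalemxAl.
  rewrite !eE !scale_scalar_mx -raddfN -raddfD /=; congr _%:M.
  ring.
have [w wE] := IHk (ltn_trans jl lk) lk.
exists (row_mx w 0); rewrite contr_last contr_last0 wE.
by rewrite !scaler0 !addr0 mul0mx oppr0 scaler0 addr0.
Qed.

End Minors.

(** * Exactness of the Eagon-Northcott complex of a 2 x n matrix *)

Section Exactness.
Variables (R : comNzRingType) (x y : nat -> R).
Local Notation ix k i := (contr x k i).
Local Notation iy k i := (contr y k i).

(** [y_k] is regular modulo the ideal [(y_0, ..., y_(k-1))], which is the image of
    [iy k 0]. *)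
Definition regular_over (k : nat) : Prop :=
  forall (a : 'rV_(extrk 1 k)) (b : 'rV_1),
    a *m iy k 0 + y k *: b = 0 -> exists a', b = a' *m iy k 0.

Definition koszul_exact (k : nat) : Prop :=
  forall i (v : 'rV_(extrk i.+1 k)),
    v *m iy k i = 0 -> exists w, v = w *m iy k i.+1.

(** In a cycle [a + e /\ b] the coefficient [b] is itself a cycle, hence a
    boundary [iy c] (in degree 0 this is the regularity of the new element);
    then [a + y_k c] is a cycle of the smaller complex. *)
Lemma koszul_exactS k :
  regular_over k -> koszul_exact k -> koszul_exact k.+1.
Proof.
move=> reg ex [|i] v.
  rewrite -[v](@hsubmxK _ 1 (extrk 1 k) 1) contr_last0.
  move: (lsubmx _) (rsubmx _) => a b abE.
  have [c bE] := reg _ _ abE.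
  have [a' a'E] : exists a', a + y k *: c = a' *m iy k 1.
    by apply: ex; rewrite mulmxDl -scalemxAl -bE.
  exists (row_mx a' (- c)); rewrite contr_last -a'E mulNmx opprK bE.
  by rewrite scalerN addrK.
rewrite -[v](@hsubmxK _ 1 (extrk i.+2 k) (extrk i.+1 k)) contr_last.
move: (lsubmx _) (rsubmx _) => a b.
rewrite -[0](@row_mx0 _ 1 (extrk i.+1 k) (extrk i k)) => /eq_row_mx[abE].
move/eqP; rewrite oppr_eq0 => /eqP/ex[c bE].
have [a' a'E] : exists a', a + y k *: c = a' *m iy k i.+2.
  by apply: ex; rewrite mulmxDl -scalemxAl -bE.
exists (row_mx a' (- c)); rewrite contr_last -a'E mulNmx opprK bE.
by rewrite scalerN addrK.
Qed.

(** Exactness of the Eagon-Northcott complex, augmented to [R] by [ix] then [iy],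
    at its term of homological degree 0, and ([en_exactS]) [i + 1].  Only the
    terms [w 0, ..., w i.+1] of a sequence matter. *)
Definition en_exact0 (k : nat) : Prop :=
  forall w : 'rV_(extrk 2 k), w *m ix k 1 *m iy k 0 = 0 ->
    exists z : nat -> 'rV_(extrk 3 k), w = z 1 *m ix k 2 + z 0 *m iy k 2.

Definition en_exactS (k : nat) : Prop :=
  forall i (w : nat -> 'rV_(extrk i.+3 k)),
    (forall a, (a < i.+1)%N ->
       w a.+1 *m ix k i.+2 + w a *m iy k i.+2 = 0) ->
    exists z : nat -> 'rV_(extrk i.+4 k), forall a, (a <= i.+1)%N ->
      w a = z a.+1 *m ix k i.+3 + z a *m iy k i.+3.

(** The terms [q_1, ..., q_(i+1)] satisfy the cycle equations of the complex one
    degree below, which gives [s_1, s_2, ...]; then [q_0 - s_1 ix] is a Koszul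
    cycle for [y], which gives [s_0].  When [i = 0] there is no cycle equation
    on [q_1] alone, but contracting [q_1 ix = - q_0 iy] by [y] shows that [q_1]
    is killed by the augmentation. *)
Lemma strand_exact k : koszul_exact k -> en_exact0 k -> en_exactS k ->
  forall i (q : nat -> 'rV_(extrk i.+2 k)),
    (forall a, (a < i.+1)%N ->
       q a.+1 *m ix k i.+1 + q a *m iy k i.+1 = 0) ->
    exists s : nat -> 'rV_(extrk i.+3 k), forall a, (a <= i.+1)%N ->
      q a = s a.+1 *m ix k i.+2 + s a *m iy k i.+2.
Proof.
move=> exy ex0 exS i q qcyc.
have [s sE] : exists s : nat -> 'rV_(extrk i.+3 k), forall a, (a <= i)%N ->
    q a.+1 = s a.+1 *m ix k i.+2 + s a *m iy k i.+2.
  case: i q qcyc => [|i] q qcyc.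
    have [|z zE] := ex0 (q 1%N).
      have /eqP := qcyc 0%N isT; rewrite addr_eq0 => /eqP ->.
      by rewrite mulNmx -mulmxA contr_sq mulmx0 oppr0.
    by exists z => -[].
  have [|z zE] := exS i (q \o succn).
    by move=> a ai; apply: qcyc.
  by exists z.
(* [s] is indexed from 0 here, so that [s 0] is the term called [s_1] above *)
have [s0 s0E] : exists s0, q 0%N - s 0%N *m ix k i.+2 = s0 *m iy k i.+2.
  apply: exy; rewrite mulmxBl -[_ *m ix _ _ *m _]mulmxA contr_anti mulmxN.
  rewrite opprK.
  have /eqP := qcyc 0%N isT; rewrite addr_eq0 sE // mulmxDl.
  rewrite -!mulmxA !contr_sq mulmx0 add0r => /eqP ->.
  by rewrite subrr.
exists (fun a => if a is a'.+1 then s a' else s0) => -[|a] ai /=.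
  by rewrite -s0E addrC subrK.
exact: sE.
Qed.

(** With [v = sum_j v_j e_j], this says that [sum_j v_j (x_j y_k - x_k y_j)] is
    in the ideal of minors of the first [k] columns only if [sum_j v_j y_j] is. *)
Definition colon_cond (k : nat) : Prop :=
  forall (v : 'rV_(extrk 1 k)) (w : 'rV_(extrk 2 k)),
    y k *: (v *m ix k 0) - x k *: (v *m iy k 0) = w *m ix k 1 *m iy k 0 ->
    exists w' : 'rV_(extrk 2 k), v *m iy k 0 = w' *m ix k 1 *m iy k 0.

(** Split [w = p + e /\ q] along the last column.  The colon condition makes
    [q - w' ix] a Koszul cycle for some [w'], so [q] is the [e]-part of a
    boundary; subtracting this boundary leaves a cycle of the smaller matrix. *)
Lemma en_exact0_S k : colon_cond k -> koszul_exact k -> en_exact0 k ->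
  en_exact0 k.+1.
Proof.
move=> colon exy ex0 w.
rewrite -[w](@hsubmxK _ 1 (extrk 2 k) (extrk 1 k)).
move: (lsubmx _) (rsubmx _) => p q.
rewrite contr_last contr_last0 mulmxDl -scalemxAl -addrA scalerN => pqE.
have [w' qE] : exists w', q *m iy k 0 = w' *m ix k 1 *m iy k 0.
  by apply: (colon q p); apply/esym/eqP; rewrite -subr_eq0 opprB pqE.
have [s0 s0E] : exists s0, q - w' *m ix k 1 = s0 *m iy k 1.
  by apply: exy; rewrite mulmxBl qE subrr.
have {s0E}qE' : q = w' *m ix k 1 + s0 *m iy k 1 by rewrite -s0E addrC subrK.
have [|z zE] := ex0 (p + x k *: w' + y k *: s0).
  move: pqE; rewrite qE' !mulmxDl -!scalemxAl.
  rewrite -[s0 *m iy _ _ *m iy _ _]mulmxA contr_sq mulmx0.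
  rewrite -[w' *m ix _ _ *m ix _ _]mulmxA contr_sq mulmx0.
  rewrite -[s0 *m ix _ _ *m iy _ _]mulmxA contr_anti mulmxN.
  by rewrite add0r addr0 scalerN -addrA mulmxA.
exists (fun a => if a is 0 then row_mx (z 0%N) (- s0)
                 else row_mx (z 1%N) (- w')).
rewrite !contr_last !mulNmx !opprK.
rewrite [RHS](@add_row_mx _ 1 (extrk 2 k) (extrk 1 k)) -qE'.
by congr row_mx; rewrite !scalerN addrACA -zE -opprD -(addrA p) addrK.
Qed.

Lemma en_exactS_S k : koszul_exact k -> en_exact0 k -> en_exactS k ->
  en_exactS k.+1.
Proof.
move=> exy ex0 exS i w wcyc.
have wE a : w a = row_mx (@lsubmx _ 1 (extrk i.+3 k) (extrk i.+2 k) (w a))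
                         (@rsubmx _ 1 (extrk i.+3 k) (extrk i.+2 k) (w a)).
  by rewrite hsubmxK.
set p := fun a => @lsubmx _ 1 (extrk i.+3 k) (extrk i.+2 k) (w a).
set q := fun a => @rsubmx _ 1 (extrk i.+3 k) (extrk i.+2 k) (w a).
have {}wE a : w a = row_mx (p a) (q a) by exact: wE.
have pqcyc a : (a < i.+1)%N ->
  (p a.+1 *m ix k i.+2 + x k *: q a.+1) + (p a *m iy k i.+2 + y k *: q a) = 0
  /\ q a.+1 *m ix k i.+1 + q a *m iy k i.+1 = 0.
  move=> /wcyc; rewrite !wE !contr_last.
  rewrite [LHS](@add_row_mx _ 1 (extrk i.+2 k) (extrk i.+1 k)).
  rewrite -[0](@row_mx0 _ 1 (extrk i.+2 k) (extrk i.+1 k)) => /eq_row_mx[-> qE].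
  by split=> //; apply/eqP; rewrite -oppr_eq0 opprD qE.
have [s sE] := strand_exact exy ex0 exS (fun a ai => proj2 (pqcyc a ai)).
have [|z zE] := exS i (fun a => p a + x k *: s a.+1 + y k *: s a).
  move=> a ai; have [pE _] := pqcyc a ai; rewrite -{}[RHS]pE.
  rewrite !sE //; last exact: ltnW.
  rewrite !mulmxDl -!scalemxAl !scalerDr.
  by rewrite (AC (3*3) ((1*(2*5))*(4*(3*6)))).
exists (fun a => row_mx (z a) (- s a)) => a ai.
rewrite wE !contr_last !mulNmx !opprK.
rewrite [RHS](@add_row_mx _ 1 (extrk i.+3 k) (extrk i.+2 k)) -sE //.
congr row_mx; rewrite !scalerN addrACA -zE //.
by rewrite -opprD -(addrA (p a)) addrK.
Qed.

Lemma koszul_exactP n :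
  (forall k, (k < n)%N -> regular_over k) -> koszul_exact n.
Proof.
elim: n => [_ i v _|n IHn reg].
  by exists 0; rewrite mul0mx; apply: thinmx0.
apply: koszul_exactS; first exact: reg.
by apply: IHn => k kn; apply: reg; rewrite ltnW.
Qed.

Lemma eagon_northcott_exact n :
  (forall k, (k < n)%N -> regular_over k) ->
  (forall k, (k < n)%N -> colon_cond k) ->
  en_exact0 n /\ en_exactS n.
Proof.
elim: n => [_ _|n IHn reg colon].
  split=> [w _|i w _].
    by exists (fun=> 0); apply/matrixP => i [].
  by exists (fun=> 0) => a _; apply/matrixP => j [].
have [ex0 exS] : en_exact0 n /\ en_exactS n.
  by apply: IHn => k kn; [apply: reg | apply: colon]; apply: ltnW.
have exy : koszul_exact n.
  by apply: koszul_exactP => k kn; apply: reg; apply: ltnW.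
by split; [apply: en_exact0_S => //; apply: colon | apply: en_exactS_S].
Qed.

End Exactness.

(** * The Eagon-Northcott complex as a graded free complex *)

Section MinimalTor.
Variables (K : fieldType) (n : nat) (F : free_complex K n).

(** When the differentials vanish modulo the variables, Tor has a basis given by
    that of the free modules. *)
Lemma tor_dim_minimal : (forall i, diffK F i = 0) ->
  forall i j, tor_dim F i j <> 0%N <-> exists l : 'I_(rk F i), twist l = j.
Proof.
move=> dF0 i j.
have cycF : (cyclesK F i :=: 1%:M)%MS.
  by case: i => [//|i] /=; rewrite dF0; apply: kermx0.
rewrite /tor_dim (cap_eqmx cycF (eqmx_refl _)) cap1mx dF0 cap0mx mxrank0 subn0.
split=> [/eqP|[l twl]].
  rewrite mxrank_eq0 => deg_neq0.
  have [l /eqP twl|tw_neq] := pickP (fun l : 'I_(rk F i) => twist l == j).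
    by exists l.
  case/eqP: deg_neq0; apply/matrixP => a b; rewrite !mxE tw_neq.
  by rewrite mul0rn.
apply/eqP; rewrite mxrank_eq0; apply/eqP => /matrixP/(_ l l)/eqP.
by rewrite !mxE eqxx twl eqxx oner_eq0.
Qed.
End MinimalTor.

Section Homog.
Variables (K : fieldType) (n : nat).
Implicit Types (d e : int) (f g : {mpoly K[n]}).

Lemma homog_of_deg0 d : homog_of_deg d (0 : {mpoly K[n]}).
Proof. by case: d => m //=; rewrite rpred0. Qed.

Lemma homog_of_degD d f g :
  homog_of_deg d f -> homog_of_deg d g -> homog_of_deg d (f + g).
Proof.
by case: d => m /= => [|-> ->]; [exact: rpredD | rewrite addr0].
Qed.

Lemma homog_of_degN d f : homog_of_deg d f -> homog_of_deg d (- f).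
Proof. by case: d => m /= => [|->]; rewrite ?rpredN ?oppr0. Qed.

Lemma homog_of_degMb d f (b : bool) :
  homog_of_deg d f -> homog_of_deg d (b%:R * f).
Proof. by case: b; rewrite ?mul1r // mul0r => _; apply: homog_of_deg0. Qed.

Lemma homog_of_degM d e f g :
  homog_of_deg d f -> homog_of_deg e g -> homog_of_deg (d + e) (f * g).
Proof.
case: d => d /=; last by move=> ->; rewrite mul0r => _; apply: homog_of_deg0.
move=> fd; case: e => e /=; first exact: dhomogM.
by move=> ->; rewrite mulr0; apply: homog_of_deg0.
Qed.

Lemma homog_of_deg_sum (I : finType) d (F : I -> {mpoly K[n]}) :
  (forall i, homog_of_deg d (F i)) -> homog_of_deg d (\sum_i F i).
Proof.
move=> Fd; elim/big_ind: _ => // [|f g].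
  exact: homog_of_deg0.
exact: homog_of_degD.
Qed.

End Homog.

(** The degree of a basis vector of an exterior power: the sum of the [d j] over
    the columns [j] occurring in it. *)
Fixpoint extdeg (d : nat -> nat) (k i : nat) {struct k} :
    'I_(extrk i k) -> nat :=
  match k return 'I_(extrk i k) -> nat with
  | 0 => fun=> 0%N
  | k'.+1 => match i return 'I_(extrk i k'.+1) -> nat with
    | 0 => fun=> 0%N
    | i'.+1 => fun l => match @split (extrk i'.+1 k') (extrk i' k') l with
        | inl l' => @extdeg d k' i'.+1 l'
        | inr l' => (@extdeg d k' i' l' + d k')%N
        end
    end
  end.

Section Extdeg.
Variable d : nat -> nat.

Lemma extdegl k i (l : 'I_(extrk i.+1 k)) :
  extdeg d (lshift (extrk i k) l : 'I_(extrk i.+1 k.+1)) = extdeg d l.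
Proof. by rewrite /= (unsplitK (inl l)). Qed.

Lemma extdegr k i (l : 'I_(extrk i k)) :
  extdeg d (rshift (extrk i.+1 k) l : 'I_(extrk i.+1 k.+1))
    = (extdeg d l + d k)%N.
Proof. by rewrite /= (unsplitK (inr l)). Qed.

Lemma extdeg0 k (l : 'I_(extrk 0 k)) : extdeg d l = 0%N.
Proof. by case: k l. Qed.

Lemma contr_homog (K : fieldType) (N : nat) (c : nat -> {mpoly K[N]}) k i b b' :
  (forall j, (j < k)%N -> c j \is (d j).-homog) ->
  homog_of_deg ((extdeg d b)%:Z - (extdeg d b')%:Z) (contr c k i b b').
Proof.
have scal_homog k' i' (a a' : 'I_(extrk i' k')) e f : f \is e.-homog ->
    homog_of_deg (((extdeg d a) + e)%:Z - (extdeg d a')%:Z)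
                 ((f%:M : 'M[{mpoly K[N]}]_(extrk i' k')) a a').
  move=> fe; rewrite mxE; case: eqP => [->|_]; last exact: homog_of_deg0.
  by rewrite PoszD addrAC subrr add0r.
elim: k i b b' => [|k IHk] [|i] b b' cd; first by case: b.
- by case: b.
- have b'E : @extdeg d k.+1 0 b' = @extdeg d k 0 b' by rewrite !extdeg0.
  case: (@split_ordP (extrk 1 k) 1 b) => {}b ->.
    rewrite contrS0 extdegl col_mxEu b'E.
    by apply: IHk => j jk; apply: cd; exact: ltnW.
  rewrite contrS0 extdegr col_mxEd b'E.
  exact/scal_homog/cd.
rewrite contrSS.
case: (@split_ordP (extrk i.+2 k) (extrk i.+1 k) b) => {}b ->;
case: (@split_ordP (extrk i.+1 k) (extrk i k) b') => {}b' ->.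
- rewrite block_mxEul !extdegl; apply: IHk => j jk; apply: cd; exact: ltnW.
- by rewrite block_mxEur mxE; apply: homog_of_deg0.
- rewrite block_mxEdl extdegl extdegr; exact/scal_homog/cd.
- rewrite block_mxEdr mxE !extdegr PoszD PoszD opprD addrACA subrr addr0.
  by apply/homog_of_degN/IHk => j jk; apply: cd; exact: ltnW.
Qed.

Lemma extrk_gt0 k i : (0 < extrk i k)%N = (i <= k)%N.
Proof.
elim: k i => [|k IHk] [|i] //.
change (extrk i.+1 k.+1) with (extrk i.+1 k + extrk i k)%N.
by rewrite addn_gt0 !IHk ltnS; case: ltngtP.
Qed.

End Extdeg.

Section EagonNorthcott.
Variables (R : comNzRingType) (x y : nat -> R) (n : nat).
Local Notation ix i := (contr x n i).
Local Notation iy i := (contr y n i).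

(** The sequences [w_0, ..., w_i] are the rows of a matrix, so [lin_mx] turns the
    differential into a matrix acting on flattened sequences.  Both [rowsub]
    drop one row of [w]: the first for [lift ord0], which shifts the indices,
    the last for [lift ord_max]. *)
Definition en_map (i : nat) (w : 'M[R]_(i.+2, extrk i.+3 n)) :
    'M[R]_(i.+1, extrk i.+2 n) :=
  rowsub (lift ord0) w *m ix i.+2 + rowsub (lift ord_max) w *m iy i.+2.

Definition en_aug (w : 'M[R]_(1, extrk 2 n)) : 'M[R]_(1, 1) :=
  w *m ix 1 *m iy 0.

Fact en_map_linear i : linear (@en_map i).
Proof.
move=> a u v; rewrite /en_map !linearP /= !mulmxDl -!scalemxAl scalerDr.
by rewrite addrACA.
Qed.

HB.instance Definition _ i :=
  GRing.isLinear.Build R _ _ _ (@en_map i) (@en_map_linear i).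

Fact en_aug_linear : linear en_aug.
Proof. by move=> a u v; rewrite /en_aug !mulmxDl -!scalemxAl. Qed.

HB.instance Definition _ :=
  GRing.isLinear.Build R _ _ _ en_aug en_aug_linear.

Lemma row_en_map i (w : nat -> 'rV_(extrk i.+3 n)) (a : 'I_i.+1) :
  row a (en_map (\matrix_(b < i.+2) w b)) = w a.+1 *m ix i.+2 + w a *m iy i.+2.
Proof.
rewrite /en_map linearD /= !row_mul !row_rowsub !rowK.
by rewrite !lift0 lift_max.
Qed.

Lemma en_aug_map w : en_aug (@en_map 0 w) = 0.
Proof.
rewrite /en_aug /en_map !mulmxDl -[_ *m ix 2 *m ix 1]mulmxA contr_sq mulmx0.
rewrite -[_ *m iy 2 *m ix 1]mulmxA contr_anti mulmxN mulmxA mulNmx -mulmxA.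
by rewrite contr_sq mulmx0 mul0mx oppr0 addr0.
Qed.

(** The contractions by [x] and by [y] square to zero and anticommute. *)
Lemma en_map_map i w : en_map (@en_map i.+1 w) = 0.
Proof.
apply/row_matrixP => a; rewrite row0.
have wE : w = \matrix_(b < i.+3) row (inord b) w.
  by apply/row_matrixP => b; rewrite rowK inord_val.
have eE : en_map w = \matrix_(b < i.+2)
   (row (inord b.+1) w *m ix i.+3 + row (inord b) w *m iy i.+3).
  apply/row_matrixP => b.
  by rewrite rowK [in LHS]wE (row_en_map (fun a => row (inord a) w)).
rewrite eE (row_en_map (fun b =>
  row (inord b.+1) w *m ix i.+3 + row (inord b) w *m iy i.+3)).
rewrite !mulmxDl -!mulmxA !contr_sq !mulmx0 add0r addr0.
by rewrite contr_anti mulmxN addNr.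
Qed.

Lemma en_map_onto i (v : 'M[R]_(i.+1, extrk i.+2 n))
    (z : nat -> 'rV_(extrk i.+3 n)) :
  (forall a, (a <= i)%N ->
     row (inord a) v = z a.+1 *m ix i.+2 + z a *m iy i.+2) ->
  v = en_map (\matrix_(b < i.+2) z b).
Proof.
move=> vE; apply/row_matrixP => a; rewrite row_en_map -vE -1?ltnS //.
by rewrite inord_val.
Qed.

Lemma en_aug_exact : en_exact0 x y n ->
  forall w, en_aug w = 0 -> exists z, w = en_map z.
Proof.
move=> ex0 w /= w0.
have [z zE] := ex0 _ w0.
exists (\matrix_(b < 2) z b); apply: en_map_onto => -[] // _.
by rewrite -zE; apply/rowP => j; rewrite mxE [inord 0]ord1.
Qed.

Lemma en_map_exact i : en_exactS x y n ->
  forall w, @en_map i w = 0 -> exists z, w = en_map z.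
Proof.
move=> exS w w0.
have wE : w = \matrix_(b < i.+2) row (inord b) w.
  by apply/row_matrixP => b; rewrite rowK inord_val.
have [|z zE] := exS i (fun a => row (inord a) w).
  move=> a ai; have := congr1 (row (Ordinal ai)) w0.
  by rewrite [in LHS]wE (row_en_map (fun a => row (inord a) w)) row0.
by exists (\matrix_(b < i.+3) z b); apply: en_map_onto.
Qed.

End EagonNorthcott.

Section Resolution.
Variables (K : fieldType) (N : nat) (x y : nat -> {mpoly K[N]}).
Variables (d : nat -> nat) (n : nat).
Local Notation S := {mpoly K[N]}.

Definition en_complex : free_complex K N :=
  @FreeComplex K N (fun i => i.+1 * extrk i.+2 n)%N
    (fun i l => mxvec (\matrix_(a < i.+1, b < extrk i.+2 n)
                         (@extdeg d n i.+2 b)%:Z) 0 l)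
    (lin_mx (en_aug x y (n := n)))
    (fun i => lin_mx (@en_map _ x y n i)).

Lemma twist_en i (a : 'I_i.+1) (b : 'I_(extrk i.+2 n)) :
  twist (f := en_complex) (mxvec_index a b) = (@extdeg d n i.+2 b)%:Z.
Proof. by rewrite /= mxvecE mxE. Qed.

Lemma diff_en i (a : 'I_i.+2) (b : 'I_(extrk i.+3 n)) a' b' :
  diff en_complex i (mxvec_index a b) (mxvec_index a' b') =
    (a == lift ord0 a')%:R * contr x n i.+2 b b' +
    (a == lift ord_max a')%:R * contr y n i.+2 b b'.
Proof.
rewrite /= /lin_mx /lin1_mx mxE /= vec_mx_delta mxvecE.
have entry f c : (rowsub f (delta_mx a b : 'M[S]_(i.+2, extrk i.+3 n))
    *m contr c n i.+2) a' b' = (a == f a')%:R * contr c n i.+2 b b'.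
  rewrite mxE (bigD1 b) //= big1 => [|b1 b1b]; rewrite !mxE.
    by rewrite eqxx andbT addr0 eq_sym.
  by rewrite (negPf b1b) andbF mul0r.
by rewrite mxE !entry.
Qed.

Lemma mul_augm_en (v : 'rV_(rk en_complex 0)) :
  v *m augm en_complex = mxvec (en_aug x y (vec_mx v)) :> 'M_(1, 1 * 1).
Proof. exact: (mul_rV_lin (en_aug x y (n := n))). Qed.

Lemma mul_diff_en i (v : 'rV_(rk en_complex i.+1)) :
  v *m diff en_complex i = mxvec (en_map x y (vec_mx v)).
Proof. exact: (mul_rV_lin (@en_map _ x y n i)). Qed.

Hypothesis x_homog : forall j, (j < n)%N -> x j \is (d j).-homog.
Hypothesis y_homog : forall j, (j < n)%N -> y j \is (d j).-homog.

Lemma mxvec11 (A : 'M[S]_1) : (mxvec A : 'M_(1, 1 * 1)) 0 0 = A 0 0.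
Proof. by rewrite -[RHS]mxvecE; congr (mxvec A 0 _); rewrite [RHS]ord1. Qed.

Lemma augm_en_homog k : homog_of_deg (twist k) (augm en_complex k 0).
Proof.
case/mxvec_indexP: k => a b; rewrite (twist_en a b).
have -> : augm en_complex (mxvec_index a b) 0 =
    (en_aug x y (delta_mx a b : 'M_(1, extrk 2 n))) 0 0.
  rewrite -mxvec11 -(mxvecK (delta_mx a b)) -mul_augm_en mxvec_delta.
  by rewrite -rowE [RHS]mxE.
rewrite /en_aug [a]ord1 -rowE mxE; apply: homog_of_deg_sum => c.
rewrite mxE -[(extdeg d b)%:Z](subrK (extdeg d c)%:Z).
apply: homog_of_degM; first exact: contr_homog.
by have := @contr_homog d _ _ y n 0 c ord0 y_homog; rewrite extdeg0 subr0.
Qed.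

Lemma en_resolution (M : S -> Prop) :
    (forall f, M f <-> exists w : 'rV_(extrk 2 n),
        f%:M = w *m contr x n 1 *m contr y n 0) ->
    en_exact0 x y n -> en_exactS x y n ->
  free_resolution M en_complex.
Proof.
move=> ME ex0 exS; split.
- exact: augm_en_homog.
- move=> i k l; case/mxvec_indexP: k => a b; case/mxvec_indexP: l => a' b'.
  rewrite diff_en !twist_en.
  by apply: homog_of_degD; apply/homog_of_degMb/contr_homog.
- move=> f; split=> [/ME[w wE]|[v ->]].
    exists (mxvec (w : 'M_(1, _))).
    by rewrite mul_augm_en mxvecK mxvec11 /en_aug -wE mxE eqxx.
  apply/ME; exists (vec_mx v); rewrite mul_augm_en mxvec11.
  by rewrite -mx11_scalar.
- move=> v; rewrite mul_augm_en; split=> [v0|[w ->]].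
    have [|z zE] := en_aug_exact ex0 (w := vec_mx v).
      by apply: (can_inj mxvecK); rewrite [LHS]v0 linear0.
    by exists (mxvec z); rewrite mul_diff_en mxvecK -zE vec_mxK.
  by rewrite mul_diff_en mxvecK en_aug_map linear0.
- move=> i v; rewrite mul_diff_en; split=> [v0|[w ->]].
    have [|z zE] := en_map_exact exS (w := vec_mx v).
      by apply: (can_inj mxvecK); rewrite v0 linear0.
    by exists (mxvec z); rewrite mul_diff_en mxvecK -zE vec_mxK.
  by rewrite mul_diff_en mxvecK en_map_map linear0.
Qed.

Lemma en_minimal i :
    (forall j, (j < n)%N -> (x j)@_0%MM = 0) ->
    (forall j, (j < n)%N -> (y j)@_0%MM = 0) ->
  diffK en_complex i = 0.
Proof.
move=> x0 y0; apply/matrixP => k l; rewrite [LHS]mxE [RHS]mxE.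
case/mxvec_indexP: k => a b; case/mxvec_indexP: l => a' b'.
have contr0 c : (forall j, (j < n)%N -> (c j)@_0%MM = 0) ->
    (contr c n i.+2 b b')@_0%MM = 0.
  move=> c0; have /matrixP/(_ b b') : map_mx (mcoeff 0%MM) (contr c n i.+2) = 0.
    rewrite map_contr; apply: contr_eq0 => j; exact: c0.
  by rewrite !mxE.
rewrite diff_en mcoeffD !rmorphM /= !contr0 //.
by rewrite !mulr0 addr0.
Qed.

End Resolution.

Section ExtdegBounds.
Variables (d : nat -> nat).

Lemma extdeg_ones k i (l : 'I_(extrk i k)) :
  (forall j, (j < k)%N -> d j = 1%N) -> extdeg d l = i.
Proof.
elim: k i l => [|k IHk] [|i] l d1 //; first by case: l.
case: (@split_ordP (extrk i.+1 k) (extrk i k) l) => {}l ->.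
  by rewrite extdegl IHk // => j jk; apply/d1/ltnW.
by rewrite extdegr IHk ?d1 ?addn1 // => j jk; apply/d1/ltnW.
Qed.

(** A subset of the columns contains the last one, the only one of degree
    [a + 1], at most once. *)
Lemma extdeg_last k i (l : 'I_(extrk i k.+1)) a :
  (forall j, (j < k)%N -> d j = 1%N) -> d k = a.+1 -> (extdeg d l <= i + a)%N.
Proof.
move=> d1 dk; case: i l => [|i] l //.
case: (@split_ordP (extrk i.+1 k) (extrk i k) l) => {}l ->.
  by rewrite extdegl extdeg_ones // leq_addr.
by rewrite extdegr extdeg_ones // dk addnS.
Qed.

Lemma extdeg_top k a :
  (forall j, (j < k)%N -> d j = 1%N) -> d k = a.+1 ->
  exists l : 'I_(extrk k.+1 k.+1), extdeg d l = (k.+1 + a)%N.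
Proof.
move=> d1 dk; have lt0 : (0 < extrk k k)%N by rewrite extrk_gt0.
exists (rshift (extrk k.+1 k) (Ordinal lt0)).
by rewrite extdegr extdeg_ones // dk addnS.
Qed.

End ExtdegBounds.

Section PdimReg.
Variables (K : fieldType) (N : nat) (x y : nat -> {mpoly K[N]}).
Variables (M : {mpoly K[N]} -> Prop) (p a : nat).
Let d j := if j == p.+1 then a.+1 else 1%N.

(** By minimality the nonzero graded Betti numbers are at the degrees of the basis
    vectors.  The last nonzero module, in homological degree [p], has the full
    set of columns as its only subset; this one attains both maxima. *)
Lemma en_pdim_reg :
    (forall f, M f <-> minors_ideal x y p.+2 f) ->
    (forall j, (j < p.+2)%N -> x j \is (d j).-homog) ->
    (forall j, (j < p.+2)%N -> y j \is (d j).-homog) ->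
    en_exact0 x y p.+2 -> en_exactS x y p.+2 ->
  is_pdim M p%:Z /\ is_reg M (a.+2)%:Z.
Proof.
move=> ME xh yh ex0 exS.
pose F := en_complex x y d p.+2.
have resF : free_resolution M F by apply: en_resolution.
have d_gt0 j : (0 < d j)%N by rewrite /d; case: ifP.
have const0 (f : {mpoly K[N]}) e : (0 < e)%N -> f \is e.-homog -> f@_0%MM = 0.
  by move=> e0 fe; apply: dhomog_nemf_coeff fe _; rewrite /= mdeg0 neq_ltn e0.
have minF i : diffK F i = 0.
  by apply: en_minimal => j jp; apply: const0 (d_gt0 j) _; auto.
have d1 j : (j < p.+1)%N -> d j = 1%N by move=> jp; rewrite /d ltn_eqF.
have dp : d p.+1 = a.+1 by rewrite /d eqxx.
have torF i j : tor_dim F i j <> 0%N <->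
    exists l : 'I_(extrk i.+2 p.+2), (extdeg d l)%:Z = j.
  rewrite tor_dim_minimal //; split=> [[l]|[l lj]].
    by case/mxvec_indexP: l => u v; rewrite twist_en => <-; exists v.
  by exists (mxvec_index ord0 l); rewrite twist_en.
have [top topE] := extdeg_top d1 dp.
have top_tor : tor_dim F p (extdeg d top)%:Z <> 0%N by apply/torF; exists top.
split; exists (tor_dim F); (split; first by exists F).
  split; first by exists p, (extdeg d top)%:Z.
  move=> _ [i [j [/torF[l _] ->]]]; rewrite lez_nat.
  by have := leq_ltn_trans (leq0n _) (ltn_ord l); rewrite extrk_gt0.
split; first by exists p, (extdeg d top)%:Z; split=> //; rewrite topE; lia.
move=> _ [i [j [/torF[l <-] ->]]].
have := extdeg_last l d1 dp; lia.
Qed.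

End PdimReg.

(** * Kernels of monomial maps *)

Section MonomialMap.
Variables (K : fieldType) (N M : nat) (u : 'I_N -> 'X_{1..M}).
Local Open Scope ring_scope.

Definition mnm_map (a : 'X_{1..N}) : 'X_{1..M} := (\sum_e u e *+ a e)%MM.

Definition monomial_tuple : N.-tuple {mpoly K[M]} := [tuple 'X_[u e] | e < N].

Lemma comp_monomial a :
  'X_[a] \mPo monomial_tuple = 'X_[mnm_map a].
Proof.
rewrite comp_mpolyX /mnm_map -mprodXnE; apply: eq_bigr => e _.
by rewrite tnth_mktuple.
Qed.

(** The kernel of a map sending variables to monomials is spanned by the
    binomials it contains: if [f] is killed, the image of one of its monomials
    [a] must cancel against that of another monomial [b] of [f], and
    subtracting a multiple of [X^a - X^b] shrinks the support of [f]. *)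
Lemma monomial_map_ker (I : {mpoly K[N]} -> Prop) :
    I 0 -> (forall f g, I f -> I g -> I (f + g)) ->
    (forall c f, I f -> I (c *: f)) ->
    (forall a b, mnm_map a = mnm_map b -> I ('X_[a] - 'X_[b])) ->
  forall f, f \mPo monomial_tuple = 0 -> I f.
Proof.
move=> I0 ID IZ Ibin f; move: {2}(size (msupp f)) (leqnn (size (msupp f))) => n.
elim: n f => [|n IHn] f; first by rewrite leqn0 size_eq0 msupp_eq0 => /eqP ->.
move=> fn f0; case: (eqVneq f 0) => [-> //|nzf].
case Ef: (msupp f) => [|a s]; first by rewrite (msuppnil0 Ef).
have as_uniq : uniq (a :: s) by rewrite -Ef msupp_uniq.
have fa : f@_a != 0 by rewrite -mcoeff_msupp Ef mem_head.
(* The coefficient of the image of [X^a] vanishes, so [a] is not alone there *)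
have [b bs ab] : exists2 b, b \in s & mnm_map a = mnm_map b.
  have [/hasP[b bs /eqP ab]|/hasPn no_b] :=
    boolP (has (fun b => mnm_map a == mnm_map b) s); first by exists b.
  case/eqP: fa; move/(congr1 (mcoeff (mnm_map a))): f0.
  rewrite mcoeff0 comp_mpolyEX Ef big_cons mcoeffD mcoeffZ comp_monomial.
  rewrite mcoeffX eqxx mulr1 raddf_sum /= big_seq big1 ?addr0 // => b bs.
  by rewrite mcoeffZ comp_monomial mcoeffX eq_sym (negPf (no_b b bs)) mulr0.
have -> : f = (f - f@_a *: ('X_[a] - 'X_[b])) + f@_a *: ('X_[a] - 'X_[b]).
  by rewrite subrK.
apply: ID; last exact/IZ/Ibin.
apply: IHn; last first.
  rewrite comp_mpolyB comp_mpolyZ comp_mpolyB !comp_monomial ab subrr.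
  by rewrite scaler0 f0 subr0.
rewrite -ltnS (leq_trans _ fn) // Ef /= ltnS.
apply: uniq_leq_size => // m.
rewrite !mcoeff_msupp mcoeffB mcoeffZ mcoeffB !mcoeffX.
apply: contraNT => ms; have /andP[as' _] := as_uniq.
have [<-|nam] := eqVneq a m.
  rewrite (_ : b == a = false) ?subr0 ?mulr1 ?subrr //.
  by apply: contraNF as' => /eqP <-.
have /negPf -> : b != m by apply: contraNneq ms => <-.
rewrite subrr mulr0 subr0 memN_msupp_eq0 // Ef inE negb_or eq_sym nam.
exact: ms.
Qed.

End MonomialMap.

(** * Minors of a matrix of monomials in disjoint variables *)

Lemma sum0_pos_neg k (delta : 'I_k -> int) : \sum_j delta j = 0 ->
  (forall j, delta j = 0) \/
  (exists j, 0 < delta j) /\ (exists j, delta j < 0).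
Proof.
move=> sum0.
have [j jpos|npos] := pickP (fun j => 0 < delta j); last first.
  left=> j; apply/oppr_inj; rewrite oppr0.
  apply: (psumr_eq0P (P := predT) (F := fun j => - delta j)) => // [i _|].
    by rewrite oppr_ge0 leNgt npos.
  by rewrite sumrN sum0 oppr0.
have [l lneg|nneg] := pickP (fun j => delta j < 0).
  by right; split; [exists j | exists l].
left=> i; apply: (psumr_eq0P (P := predT) (F := delta)) => // i' _.
by rewrite leNgt nneg.
Qed.

(** The variables are spread over the entries of a matrix with two rows: variable
    [e] is put in column [col e], in the first row if [side e], and the entry is
    the product of its variables. *)
Section Columns.
Variables (K : fieldType) (N : nat) (col : 'I_N -> nat) (side : 'I_N -> bool).
Local Notation S := {mpoly K[N]}.

Definition col_mnm (s : bool) (j : nat) : 'X_{1..N} :=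
  [multinom ((col e == j) && (side e == s) : nat) | e < N].
Definition xmon (j : nat) : S := 'X_[col_mnm true j].
Definition ymon (j : nat) : S := 'X_[col_mnm false j].

Lemma ymon_span k (b : 'rV[S]_1) :
  (forall m, m \in msupp (b 0 0) ->
     exists2 j, (j < k)%N & (col_mnm false j <= m)%MM) ->
  exists a, b = a *m contr ymon k 0.
Proof.
move=> supp_b; rewrite [b]mx11_scalar [b 0 0]mpolyE.
rewrite raddf_sum /= big_seq; elim/big_ind: _.
- by exists 0; rewrite mul0mx.
- by move=> f g [v ->] [w ->]; exists (v + w); rewrite mulmxDl.
move=> m /supp_b[j jk jm]; have [e eE] := contr_basis S jk.
exists ((b 0 0)@_m *: 'X_[m - col_mnm false j] *: e).
rewrite -scalemxAl eE scale_scalar_mx; congr _%:M.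
by rewrite -scalerAl -mpolyXD submK.
Qed.

Lemma span_ymon k (a : 'rV_(extrk 1 k)) m :
  m \in msupp ((a *m contr ymon k 0) 0 0) ->
  exists2 j, (j < k)%N & (col_mnm false j <= m)%MM.
Proof.
elim: k a => [|k IHk] a; first by rewrite mulmx0 mxE msupp0.
rewrite -[a](@hsubmxK _ 1 (extrk 1 k) 1) contr_last0.
move: (lsubmx _) (rsubmx _) => a1 a2; rewrite mxE.
move/msuppD_le; rewrite mem_cat => /orP[/IHk[j jk jm]|].
  by exists j => //; apply: ltnW.
rewrite mxE mulrC (perm_mem (msuppMX _ _)) => /mapP[m' _ ->].
by exists k => //; apply: lem_addr.
Qed.

(** An ideal generated by monomials contains a polynomial as soon as it contains
    its monomials, and [y_k] shares no variable with the previous [y_j]. *)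
Lemma ymon_regular k : regular_over ymon k.
Proof.
move=> a b ab0; apply: ymon_span => m mb.
have [|j jk jm] := @span_ymon k (- a) (col_mnm false k + m)%MM.
  have -> : - a *m contr ymon k 0 = ymon k *: b.
    by apply/eqP; rewrite mulNmx eq_sym -addr_eq0 addrC ab0.
  by rewrite mxE mulrC (perm_mem (msuppMX _ _)) map_f.
exists j => //; apply/mnm_lepP => e; move/mnm_lepP/(_ e): jm.
rewrite mnmDE !mnmE.
case: (col e =P j) => //= ->; case: (side e == false) => //=.
by rewrite (ltn_eqF jk) add0n.
Qed.

Local Notation Ik := (minors_ideal xmon ymon).

Definition col_shift (k : nat) (delta : nat -> int) (e : 'I_N) : int :=
  if (col e < k)%N then (if side e then delta (col e) else - delta (col e))
  else 0.

(** Suppose that [a] exceeds [b] by [delta j] on the variables of [x_j], and [b]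
    exceeds [a] by as much on those of [y_j].  If [delta j > 0 > delta l], then
    [x_j y_l] divides [X^a], and replacing it by [x_l y_j] changes [X^a] by a
    multiple of a minor and brings it closer to [X^b]. *)
Lemma fiber_binomial k (delta : nat -> int) (a b : 'X_{1..N}) :
  (forall e, (a e)%:Z = (b e)%:Z + col_shift k delta e) ->
  \sum_(j < k) delta j = 0 ->
  Ik k ('X_[a] - 'X_[b]).
Proof.
have [n] := ubnP (\sum_(j < k) `|delta j|)%N.
elim: n delta a => // n IHn delta a le_del abE sum0.
have [del0|[[j jpos] [l lneg]]] := sum0_pos_neg sum0.
  suff -> : a = b by rewrite subrr; apply: minors_ideal0.
  apply/mnmP => e; have /eqP := abE e; rewrite /col_shift.
  case: ltnP => [ek|_]; last by rewrite addr0 => /eqP[].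
  by rewrite (del0 (Ordinal ek)) oppr0 if_same addr0 => /eqP[].
have jl : (j : nat) != l.
  by apply: contraTneq jpos => /val_inj ->; rewrite -leNgt ltW.
have le_a e : ((col_mnm true j + col_mnm false l)%MM e <= a e)%N.
  have := abE e; rewrite /col_shift mnmDE !mnmE.
  case: (col e =P j) => [->|_].
    rewrite (negPf jl) addn0 ltn_ord; case: (side e) => //=; lia.
  case: (col e =P l) => [->|_] //.
  rewrite ltn_ord; case: (side e) => //=; lia.
set c := (a - (col_mnm true j + col_mnm false l))%MM.
set a' := (c + (col_mnm true l + col_mnm false j))%MM.
have aE : a = (c + (col_mnm true j + col_mnm false l))%MM.
  by rewrite /c submK //; apply/mnm_lepP.
have -> : 'X_[a] - 'X_[b] = ('X_[a] - 'X_[a']) + ('X_[a'] - 'X_[b]) :> S.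
  by rewrite addrA subrK.
apply: minors_idealD.
  rewrite {1}aE /a' !(mpolyXD _ c) -mulrBr; apply: minors_idealM.
  by rewrite !mpolyXD; apply: minor_in_ideal.
pose delta' i := delta i - (i == j :> nat)%:R + (i == l :> nat)%:R.
apply: (IHn delta').
+ rewrite -ltnS; apply: leq_trans le_del; rewrite ltnS.
  rewrite (bigD1 j) //= [X in (_ < X)%N](bigD1 j) //= -addSn leq_add //.
    rewrite /delta' eqxx (negPf jl) addr0; lia.
  apply: leq_sum => i ij; rewrite /delta'.
  move: ij; rewrite -val_eqE => /negPf ->.
  case: (i =P l :> nat) => [/val_inj ->|_]; lia.
+ move=> e; have := abE e; have := le_a e; rewrite /col_shift /delta' /a' /c.
  rewrite !mnmDE mnmBE mnmDE !mnmE.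
  case: (col e =P j) => [->|_].
    rewrite ltn_ord (negPf jl); case: (side e) => //=; lia.
  case: (col e =P l) => [->|_].
    rewrite ltn_ord; case: (side e) => //=; lia.
  case: ltnP => _; case: (side e) => /=; lia.
+ rewrite big_split sumrB sum0 /= sub0r.
  rewrite (bigD1 j) //= eqxx big1 => [|i ij]; last first.
    by move: ij; rewrite -val_eqE => /negPf ->.
  rewrite (bigD1 l) //= eqxx big1 => [|i il]; last first.
    by move: il; rewrite -val_eqE => /negPf ->.
  by rewrite !addr0 addNr.
Qed.

(** When the first [k] entries [x_j] are single variables [X_(ex j)], the ideal of
    minors of the first [k] columns is the kernel of the map [x_j |-> z y_j]
    fixing the other variables.  No new variable is needed for [z]: as [x_0]
    occurs in no image other than through [z], the variable [x_0] itself
    serves. *)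
Section Straightening.
Variables (k : nat) (ex : nat -> 'I_N).
Hypothesis k_gt0 : (0 < k)%N.
Hypothesis pure_col : forall j e, (j < k)%N ->
  ((col e == j) && side e) = (e == ex j).

Definition straighten (e : 'I_N) : 'X_{1..N} :=
  if (col e < k)%N && side e then (U_(ex 0) + col_mnm false (col e))%MM
  else U_(e)%MM.

Lemma col_ex j : (j < k)%N -> col (ex j) = j /\ side (ex j).
Proof.
by move=> jk; have := pure_col (ex j) jk; rewrite eqxx => /andP[/eqP].
Qed.

Lemma straighten_ex j : (j < k)%N ->
  straighten (ex j) = (U_(ex 0) + col_mnm false j)%MM.
Proof.
by move=> jk; have [cj sj] := col_ex jk; rewrite /straighten cj jk sj.
Qed.

Lemma mnm_map_straighten a f :
  mnm_map straighten a f =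
    (\sum_(j < k) (U_(ex 0)%MM f + col_mnm false j f) * a (ex j) +
     (if (col f < k) && side f then 0 else a f))%N.
Proof.
rewrite mnm_sumE.
transitivity (\sum_e (\sum_(j < k) ((e == ex j) * (straighten e f * a e)) +
    (if (col e < k) && side e then 0 else (e == f) * a e)))%N.
  apply: eq_bigr => e _; rewrite mulmnE.
  case: ifP => [/andP[ek es]|es].
    rewrite addn0 (bigD1 (Ordinal ek)) //= -pure_col // eqxx es mul1n.
    rewrite big1 ?addn0 //.
    move=> j; rewrite -val_eqE /= -pure_col // => jk.
    by rewrite eq_sym (negPf jk).
  rewrite big1 ?add0n => [|j _]; last first.
    rewrite -pure_col //; move: es; case: (col e =P j) => //= ->.
    by rewrite ltn_ord /= => ->.
  by rewrite /straighten es mnm1E.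
rewrite big_split exchange_big /=; congr (_ + _)%N.
  apply: eq_bigr => j _; rewrite (bigD1 (ex j)) //= eqxx mul1n big1 ?addn0.
    by rewrite straighten_ex // mnmDE.
  by move=> e /negPf ->.
rewrite (bigD1 f) //= eqxx mul1n big1 ?addn0 // => e /negPf ->.
by rewrite if_same.
Qed.

(** The coordinates of the image at [z], at the variables of [y_j] and at the other
    variables determine, in this order, the sum of the exponents of the [x_j],
    the sums of the exponents of [x_j] and of a variable of [y_j], and the
    exponents outside of the first [k] columns. *)
Lemma straighten_fiber a b :
  mnm_map straighten a = mnm_map straighten b -> Ik k ('X_[a] - 'X_[b]).
Proof.
move=> ab; have [c0 s0] := col_ex k_gt0.
have abf f : mnm_map straighten a f = mnm_map straighten b f by rewrite ab.
pose delta j : int := (a (ex j))%:Z - (b (ex j))%:Z.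
apply: (@fiber_binomial k delta); last first.
  have := abf (ex 0); rewrite !mnm_map_straighten c0 k_gt0 s0 !addn0.
  have E m :
      (\sum_(j < k) (U_(ex 0)%MM (ex 0) + col_mnm false j (ex 0)) * m (ex j) =
      \sum_(j < k) m (ex j))%N.
    by apply: eq_bigr => j _; rewrite mnm1E mnmE eqxx s0 andbF mul1n.
  rewrite !E => sab; rewrite sumrB -!(big_morph Posz PoszD (erefl 0%:Z)).
  by rewrite sab subrr.
move=> e; have := abf e; rewrite !mnm_map_straighten /col_shift.
have ex0e : ((col e < k)%N && side e) = false -> U_(ex 0)%MM e = 0%N.
  move=> es; rewrite mnm1E; case: eqP => // eE.
  by move: es; rewrite -eE c0 k_gt0 s0.
case: ltnP => ek; last first.
  have E m :
      (\sum_(j < k) (U_(ex 0)%MM e + col_mnm false j e) * m (ex j) = 0)%N.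
    apply: big1 => j _; rewrite ex0e ?mnmE 1?ltnNge ?ek //.
    by rewrite gtn_eqF ?mul0n // (leq_trans _ ek).
  by rewrite !E !add0n addr0 => ->.
case: ifP => /= es.
  move=> _; have exe : ex (col e) = e.
    by apply/eqP; rewrite eq_sym -pure_col // eqxx.
  by rewrite /delta exe es addrC subrK.
have E m : (\sum_(j < k) (U_(ex 0)%MM e + col_mnm false j e) * m (ex j) =
    m (ex (col e)))%N.
  rewrite (bigD1 (Ordinal ek)) //= big1 => [|j].
    by rewrite ex0e ?ek ?es // mnmE eqxx es mul1n addn0.
  by rewrite -val_eqE /= eq_sym => /negPf je; rewrite ex0e ?ek ?es // mnmE je.
rewrite es !E /delta; lia.
Qed.

Lemma mnm_map_fix (m : 'X_{1..N}) :
  (forall e, (col e < k)%N -> side e -> m e = 0%N) ->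
  mnm_map straighten m = m.
Proof.
move=> m0; rewrite [RHS]multinomUE_id; apply: eq_bigr => e _.
rewrite /straighten; case: ifP => // /andP[ek es].
by rewrite m0 // !mulm0n.
Qed.

Local Notation phi := (comp_mpoly (monomial_tuple K straighten)).

Lemma straighten_xmon j : (j < k)%N -> phi (xmon j) = 'X_(ex 0) * ymon j.
Proof.
move=> jk; rewrite comp_monomial -mpolyXD; congr 'X_[_].
have -> : col_mnm true j = U_(ex j)%MM.
  by apply/mnmP => e; rewrite mnmE mnm1E eqb_id pure_col // eq_sym.
rewrite /mnm_map (bigD1 (ex j)) //= mnm1E eqxx mulm1n big1 ?addm0.
  exact: straighten_ex.
by move=> e ej; rewrite mnm1E eq_sym (negPf ej) mulm0n.
Qed.

Lemma straighten_ymon j : phi (ymon j) = ymon j.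
Proof.
rewrite comp_monomial mnm_map_fix // => e ek es.
by rewrite mnmE es andbF.
Qed.

Lemma straighten_xmon_ge j : (k <= j)%N -> phi (xmon j) = xmon j.
Proof.
move=> kj; rewrite comp_monomial mnm_map_fix // => e ek es.
by rewrite mnmE (ltn_eqF (leq_trans ek kj)).
Qed.

(** The hypothesis becomes [(z y_k - x_k) sum_j v_j y_j = 0] in the target, which
    is a domain, and [z y_k] and [x_k] are distinct monomials. *)
Lemma straighten_colon : colon_cond xmon ymon k.
Proof.
move=> v w vw; set t := monomial_tuple K straighten.
suff vy0 : (v *m contr ymon k 0) 0 0 \mPo t = 0.
  have [| | |w' wE] :=
    @monomial_map_ker _ _ _ straighten (Ik k) _ _ _ straighten_fiber _ vy0.
  - exact: minors_ideal0.
  - exact: minors_idealD.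
  - by move=> c f If; rewrite -mul_mpolyC; apply: minors_idealM.
  by exists w'; rewrite -wE -mx11_scalar.
have map_x i : map_mx phi (contr xmon k i) = 'X_(ex 0) *: contr ymon k i.
  rewrite map_contr -contr_scale; apply: eq_contr => j jk /=.
  exact: straighten_xmon.
have map_y i : map_mx phi (contr ymon k i) = contr ymon k i.
  by rewrite map_contr; apply: eq_contr => j jk /=; exact: straighten_ymon.
have := congr1 (map_mx phi) vw.
rewrite map_mxB !map_mxZ !map_mxM !map_x !map_y /=.
rewrite straighten_ymon straighten_xmon_ge //.
rewrite -!scalemxAr -!scalemxAl -mulmxA (contr_sq ymon k 0) mulmx0 scaler0.
rewrite scalerA -scalerBl.
set g := map_mx phi v *m _ => eq0.
have gE : g = map_mx phi (v *m contr ymon k 0) by rewrite map_mxM map_y.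
have /eqP : (ymon k * 'X_(ex 0) - xmon k) * g 0 0 = 0.
  by move: g gE eq0 => g _ /matrixP/(_ 0 0); rewrite !mxE.
rewrite mulf_eq0 => /orP[|/eqP g0].
  rewrite subr_eq0 mulrC -mpolyXD => /eqP/(congr1 (mcoeff (col_mnm true k))).
  rewrite !mcoeffX eqxx; case: eqP => [/mnmP/(_ (ex 0))|_ /eqP].
    have [c0 s0] := col_ex k_gt0.
    by rewrite mnmDE mnm1E eqxx !mnmE c0 (ltn_eqF k_gt0) s0 andbF.
  by rewrite eq_sym oner_eq0.
by rewrite -[RHS]g0 gE [RHS]mxE.
Qed.

End Straightening.

Lemma colon_cond0 : colon_cond xmon ymon 0.
Proof. by move=> v w _; exists 0; rewrite /= !mulmx0. Qed.

End Columns.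

(** The colon condition at [k] asks for single variables only in the columns before
    the k-th, so the entries of the last column may be arbitrary monomials. *)
Lemma columns_exact (K : fieldType) N (col : 'I_N -> nat) (side : 'I_N -> bool)
    (ex : nat -> 'I_N) q :
  (forall j e, (j < q)%N -> ((col e == j) && side e) = (e == ex j)) ->
  en_exact0 (xmon K col side) (ymon K col side) q.+1 /\
  en_exactS (xmon K col side) (ymon K col side) q.+1.
Proof.
move=> pure; apply: eagon_northcott_exact => k kq; first exact: ymon_regular.
case: k kq => [_|k kq]; first exact: colon_cond0.
apply: (straighten_colon (ex := ex)) => // j e jk.
by apply: pure; apply: leq_trans jk _.
Qed.

(** * Subdivisions of directed graphs *)

(** A directed graph with vertices [W] and arcs [C] gives a bipartite graph by
    placing a new vertex in the middle of each arc.  An edge of it is a half of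
    an arc [c]: [(c, true)] joins the source of [c] to its middle and
    [(c, false)] joins the target to the middle. *)
Section Subdivision.
Variables (W C : finType) (src tgt : C -> W).
Hypothesis no_loop : forall c, src c != tgt c.

Definition arc_end (cb : C * bool) : W := if cb.2 then src cb.1 else tgt cb.1.

Definition subdiv_adj : rel (W + C) := fun u v =>
  match u, v with
  | inl w, inr c | inr c, inl w => (w == src c) || (w == tgt c)
  | _, _ => false
  end.

Fact subdiv_sym : ssrbool.symmetric subdiv_adj.
Proof. by move=> [w|c] [w'|c']. Qed.

Fact subdiv_irrefl : irreflexive subdiv_adj.
Proof. by case. Qed.

Definition subdiv : sgraph := SGraph subdiv_sym subdiv_irrefl.

Lemma subdiv_bipartite : bipartite subdiv.
Proof.
exists [set u : subdiv | if u is inl _ then true else false].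
by move=> [w|c] [w'|c'] //=; rewrite !inE.
Qed.

Definition half_arc (cb : C * bool) : {set subdiv} :=
  [set inl (arc_end cb); inr cb.1].

Lemma half_arc_inj : injective half_arc.
Proof.
move=> [c b] [c' b'] /setP eq_cb.
have := eq_cb (inr c); rewrite !inE /= eqxx => /esym/eqP[cc']; subst c'.
have := eq_cb (inl (arc_end (c, b))); rewrite !inE eqxx /= orbF.
rewrite /arc_end => /esym/eqP[].
by case: b b' {eq_cb} => [] [] //= E; have := no_loop c; rewrite E eqxx.
Qed.

Lemma edges_subdiv A : (A \in edges subdiv) = [exists cb, A == half_arc cb].
Proof.
rewrite inE; apply/existsP/existsP =>
  [[u /existsP[v /andP[uv /eqP ->]]]|[[c b] /eqP ->]].
  have half w c : subdiv_adj (inl w) (inr c) ->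
      exists cb, [set inl w; inr c] == half_arc cb.
    by move=> /orP[/eqP ->|/eqP ->]; [exists (c, true) | exists (c, false)].
  case: u v uv => [w|c] [w'|c'] //= uv; first exact: half.
  by rewrite setUC; apply: half.
exists (inl (arc_end (c, b))); apply/existsP; exists (inr c).
by rewrite eqxx andbT /= /arc_end /=; case: b; rewrite eqxx ?orbT.
Qed.

Lemma half_arc_edge cb : half_arc cb \in edges subdiv.
Proof. by rewrite edges_subdiv; apply/existsP; exists cb. Qed.

Local Notation N := #|edges subdiv|.

Definition edge_of (cb : C * bool) : 'I_N :=
  enum_rank_in (half_arc_edge cb) (half_arc cb).

Lemma enum_val_edge_of cb : enum_val (edge_of cb) = half_arc cb.
Proof. by rewrite enum_rankK_in // half_arc_edge. Qed.

Fact half_of_subproof (i : 'I_N) : exists cb, enum_val i == half_arc cb.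
Proof. by apply/existsP; rewrite -edges_subdiv enum_valP. Qed.

Definition half_of (i : 'I_N) : C * bool := xchoose (half_of_subproof i).

Lemma half_of_val i : enum_val i = half_arc (half_of i).
Proof. exact/eqP/(xchooseP (half_of_subproof i)). Qed.

Lemma edge_ofK : cancel edge_of half_of.
Proof.
by move=> cb; apply: half_arc_inj; rewrite -half_of_val enum_val_edge_of.
Qed.

Lemma half_ofK : cancel half_of edge_of.
Proof.
by move=> i; apply: enum_val_inj; rewrite enum_val_edge_of -half_of_val.
Qed.

Definition vtx (v : subdiv) : 'I_#|subdiv| := enum_rank v.

Definition edge_mnm (i : 'I_N) : 'X_{1..#|subdiv|} :=
  (U_(vtx (inl (arc_end (half_of i)))) + U_(vtx (inr (half_of i).1)))%MM.

Lemma toric_mapE (K : fieldType) (f : {mpoly K[N]}) :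
  toric_map f = f \mPo monomial_tuple K edge_mnm.
Proof.
congr (f \mPo _); apply: eq_from_tnth => i; rewrite !tnth_mktuple.
rewrite /edge_monomial half_of_val /half_arc big_setU1 ?inE //= big_set1.
by rewrite -mpolyXD.
Qed.

Lemma mnm1_vtx (u v : subdiv) : U_(vtx u)%MM (vtx v) = (u == v) :> nat.
Proof. by rewrite mnm1E (inj_eq enum_rank_inj). Qed.

Lemma sum_edges (F : 'I_N -> nat) :
  (\sum_i F i = \sum_c (F (edge_of (c, true)) + F (edge_of (c, false))))%N.
Proof.
rewrite (reindex edge_of) /=; last first.
  by apply: onW_bij; exists half_of; [exact: edge_ofK | exact: half_ofK].
rewrite [RHS](eq_bigr (fun c => \sum_b F (edge_of (c, b)))%N).
  by rewrite pair_big /=; apply: eq_bigr => -[].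
by move=> c _; rewrite big_bool.
Qed.

Lemma edge_mnm_mid (m : 'X_{1..N}) c :
  mnm_map edge_mnm m (vtx (inr c)) =
    (m (edge_of (c, true)) + m (edge_of (c, false)))%N.
Proof.
rewrite mnm_sumE sum_edges (bigD1 c) //= big1 => [|c' c'c].
  by rewrite !mulmnE !mnmDE !edge_ofK !mnm1_vtx !eqxx !mul1n addn0.
rewrite !mulmnE !mnmDE !edge_ofK !mnm1_vtx /=.
have inr_eq : (inr c' == inr c :> subdiv) = (c' == c) by [].
by rewrite inr_eq (negPf c'c).
Qed.

Lemma edge_mnm_end (m : 'X_{1..N}) w :
  mnm_map edge_mnm m (vtx (inl w)) =
    (\sum_c ((src c == w) * m (edge_of (c, true)) +
             (tgt c == w) * m (edge_of (c, false))))%N.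
Proof.
rewrite mnm_sumE sum_edges; apply: eq_bigr => c _.
rewrite !mulmnE !mnmDE !edge_ofK !mnm1_vtx /= !addn0.
by [].
Qed.

(** Exponents with the same image under the toric map differ by a circulation on
    the directed graph: a middle vertex has degree 2, so the two halves of its
    arc change by opposite amounts, and the equation at an original vertex says
    that inflow and outflow agree. *)
Lemma edge_mnm_balance (a b : 'X_{1..N}) (delta : C -> int) :
    (forall c, delta c =
       (a (edge_of (c, true)))%:Z - (b (edge_of (c, true)))%:Z) ->
    mnm_map edge_mnm a = mnm_map edge_mnm b ->
  (forall c, (a (edge_of (c, false)))%:Z =
     (b (edge_of (c, false)))%:Z - delta c)
  /\ (forall w, \sum_(c | src c == w) delta c = \sum_(c | tgt c == w) delta c).
Proof.
move=> dE ab.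
have midE c :
    (a (edge_of (c, false)))%:Z = (b (edge_of (c, false)))%:Z - delta c.
  have := congr1 (fun m : 'X_{1..#|subdiv|} => m (vtx (inr c))) ab.
  rewrite !edge_mnm_mid dE; lia.
split=> // w; apply/eqP; rewrite -subr_eq0; apply/eqP.
have := congr1 (fun m : 'X_{1..#|subdiv|} => (m (vtx (inl w)))%:Z) ab.
rewrite !edge_mnm_end !(big_morph Posz PoszD (erefl 0%:Z)) => /eqP.
rewrite -subr_eq0 -sumrB => /eqP E; rewrite -[RHS]E {E}.
rewrite [X in X - _ = _]big_mkcond [X in _ - X = _]big_mkcond -sumrB.
apply: eq_bigr => c _.
by rewrite !PoszD !PoszM midE dE; case: eqP; case: eqP => _ _ /=; lia.
Qed.

End Subdivision.

(** * The theta graph with one long path *)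

Lemma sum_ord_eq n (b : bool) (m : nat) :
  (\sum_(i < n) (b && (i == m :> nat)) = b && (m < n))%N.
Proof.
case: ltnP => [mn|nm]; last first.
  rewrite andbF big1 // => i _.
  by rewrite (ltn_eqF (leq_trans (ltn_ord i) nm)) andbF.
rewrite (bigD1 (Ordinal mn)) //= eqxx big1 ?addn0 // => i.
by rewrite -val_eqE /= => /negPf ->; rewrite andbF.
Qed.

(** A directed path [0 -> 1 -> ... -> a + 1] and [p + 1] further arcs from its
    first vertex to its last; after subdivision these become the long path and
    the paths of length 2.  The long path is the last column. *)
Section Theta.
Variables (K : fieldType) (p a : nat).
Let W := 'I_a.+2.
Let C := ('I_a.+1 + 'I_p.+1)%type.

Definition theta_src (c : C) : W :=
  match c with inl l => widen_ord (leqnSn _) l | inr _ => ord0 end.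
Definition theta_tgt (c : C) : W :=
  match c with inl l => lift ord0 l | inr _ => ord_max end.

Lemma theta_no_loop c : theta_src c != theta_tgt c.
Proof.
by case: c => [l|j]; rewrite -val_eqE //= /bump add1n neq_ltn leqnn.
Qed.

Definition theta_graph := subdiv theta_src theta_tgt.

Local Notation N := #|edges theta_graph|.
Local Notation edge := (edge_of theta_src theta_tgt).
Local Notation half := (half_of (src := theta_src) (tgt := theta_tgt)).
Local Notation emnm := (edge_mnm (src := theta_src) (tgt := theta_tgt)).

Definition arc_col (c : C) : nat :=
  match c with inl _ => p.+1 | inr j => j end.
Definition edge_col (i : 'I_N) : nat := arc_col (half i).1.
Definition edge_side (i : 'I_N) : bool := (half i).2.

Local Notation x := (xmon K edge_col edge_side).
Local Notation y := (ymon K edge_col edge_side).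
Local Notation cmnm := (col_mnm edge_col edge_side).

Lemma cmnm_edge s j c b :
  cmnm s j (edge (c, b)) = (arc_col c == j) && (b == s) :> nat.
Proof. by rewrite mnmE /edge_col /edge_side (edge_ofK theta_no_loop). Qed.

(** A circulation is constant along the long path, since each inner vertex of this
    path has one arc in and one arc out; at the first vertex its values on all
    the columns add up to zero. *)
Lemma theta_fiber (u v : 'X_{1..N}) :
  mnm_map emnm u = mnm_map emnm v ->
  minors_ideal x y p.+2 ('X_[u] - 'X_[v]).
Proof.
move=> uv.
pose delta c : int := (u (edge (c, true)))%:Z - (v (edge (c, true)))%:Z.
have [midE bal] :=
  edge_mnm_balance theta_no_loop (delta := delta) (fun=> erefl) uv.
have pathS l (la : (l < a.+1)%N) : delta (inl (Ordinal la)) = delta (inl ord0).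
  elim: l la => [|l IHl] la; first by congr (delta (inl _)); apply: val_inj.
  rewrite -(IHl (ltnW la)).
  have := bal (lift ord0 (Ordinal (ltnW la))).
  rewrite (big_pred1 (inl (Ordinal la))) => [->|]; last first.
    by move=> [m|j]; rewrite -val_eqE.
  apply: big_pred1 => -[m|j]; rewrite -val_eqE //=.
  by rewrite /bump !add1n !eqSS gtn_eqF // ltnW.
(* The value of the circulation on the column [j], read off at its first arc *)
pose coldiff j :=
  if (j < p.+1)%N then delta (inr (inord j)) else delta (inl ord0).
apply: (@fiber_binomial _ _ _ _ _ coldiff).
  move=> i; rewrite -(half_ofK i); case: (half i) => c b.
  rewrite /col_shift /edge_col /edge_side (edge_ofK theta_no_loop) /=.
  have -> : (arc_col c < p.+2)%N.
    by case: c => //= j; rewrite ltnW // ltnS ltn_ord.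
  have -> : coldiff (arc_col c) = delta c.
    case: c => [[l la]|j]; rewrite /coldiff /=; first by rewrite ltnn pathS.
    by rewrite ltn_ord inord_val.
  by case: b; rewrite ?midE // /delta addrC subrK.
have := bal ord0; rewrite [RHS]big_pred0 => [E|]; last by case.
rewrite -[RHS]E [RHS]big_sumType [LHS]big_ord_recr [LHS]addrC; congr (_ + _).
  by rewrite [LHS]/= /coldiff ltnn (big_pred1 ord0).
apply: eq_big => // j _.
by rewrite /coldiff /= ltn_ord inord_val.
Qed.

(** After the toric map the two rows of the matrix are multiples of the same row
    [X^(T j)], by the variables of the two hubs. *)
Lemma theta_minors_toric f : minors_ideal x y p.+2 f -> toric_ideal f.
Proof.
pose T j := [multinom match enum_val i with
   | inl w => ((j == p.+1) && (0 < w < a.+1)%N : nat)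
   | inr c => (arc_col c == j : nat) end | i < #|theta_graph|].
have T_end j w : T j (vtx (inl w : theta_graph)) =
    (j == p.+1) && (0 < w < a.+1)%N by rewrite mnmE enum_rankK.
have T_mid j c : T j (vtx (inr c : theta_graph)) = (arc_col c == j).
  by rewrite mnmE enum_rankK.
have emnm_mid s j c : mnm_map emnm (cmnm s j) (vtx (inr c)) = (arc_col c == j).
  rewrite (edge_mnm_mid theta_no_loop) !cmnm_edge.
  by case: s; rewrite !andbT !andbF ?addn0.
have xE j : (j < p.+2)%N ->
  mnm_map emnm (cmnm true j) = (U_(vtx (inl ord0 : theta_graph)) + T j)%MM.
  move=> jp; apply/mnmP => i; rewrite -(enum_valK i) mnmDE -/(vtx (enum_val i)).
  case: (enum_val i) => [w|c]; last by rewrite emnm_mid T_mid mnm1_vtx.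
  rewrite (edge_mnm_end theta_no_loop) T_end mnm1_vtx.
  rewrite (eq_bigr (fun c => (theta_src c == w) && (arc_col c == j) : nat)).
    rewrite big_sumType /= sum_ord_eq.
    rewrite (eq_bigr (fun i : 'I_a.+1 =>
        (p.+1 == j) && (i == w :> nat) : nat)); last first.
      by move=> l _; rewrite andbC -val_eqE.
    rewrite sum_ord_eq.
    rewrite (_ : (inl ord0 == inl w :> theta_graph) = (0 == w :> nat)) //.
    rewrite -val_eqE /=; case: w => [[|w'] wa] /=; lia.
  by move=> c _; rewrite !cmnm_edge /= andbT andbF muln0 addn0 mulnb.
have yE j : (j < p.+2)%N ->
  mnm_map emnm (cmnm false j) = (U_(vtx (inl ord_max : theta_graph)) + T j)%MM.
  move=> jp; apply/mnmP => i; rewrite -(enum_valK i) mnmDE -/(vtx (enum_val i)).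
  case: (enum_val i) => [w|c]; last by rewrite emnm_mid T_mid mnm1_vtx.
  rewrite (edge_mnm_end theta_no_loop) T_end mnm1_vtx.
  rewrite (eq_bigr (fun c => (theta_tgt c == w) && (arc_col c == j) : nat)).
    rewrite big_sumType /= sum_ord_eq.
    rewrite (eq_bigr (fun i : 'I_a.+1 =>
        (p.+1 == j) && (0 < w)%N && (i == w.-1 :> nat) : nat)); last first.
      move=> l _; rewrite -val_eqE /= /bump add1n.
      by case: (nat_of_ord w) => [|w']; rewrite ?andbF // eqSS andbT andbC.
    rewrite sum_ord_eq.
    rewrite (_ : (inl ord_max == inl w :> theta_graph) = (a.+1 == w :> nat)) //.
    rewrite -val_eqE /=.
    by case: w => [[|w'] wa] /=; lia.
  by move=> c _; rewrite !cmnm_edge /= andbT andbF muln0 add0n mulnb.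
move=> [w wE]; rewrite /toric_ideal toric_mapE.
set th := comp_mpoly _.
have mapE s c i : (forall j, (j < p.+2)%N -> th (c j) = 'X_s * 'X_[T j]) ->
    map_mx th (contr c p.+2 i) = 'X_s *: contr (fun j => 'X_[T j]) p.+2 i.
  move=> cE; rewrite map_contr -contr_scale; apply: eq_contr => j jp /=.
  exact: cE.
have := congr1 (map_mx th) wE.
rewrite !map_mxM (mapE (vtx (inl ord0 : theta_graph))); last first.
  by move=> j jp; rewrite /th comp_monomial xE // mpolyXD.
rewrite (mapE (vtx (inl ord_max : theta_graph))); last first.
  by move=> j jp; rewrite /th comp_monomial yE // mpolyXD.
rewrite -!scalemxAr -!scalemxAl -mulmxA (contr_sq _ p.+2 0) mulmx0 !scaler0.
by rewrite map_scalar_mx => /matrixP/(_ 0 0); rewrite !mxE eqxx.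
Qed.

Lemma theta_toricE f : toric_ideal f <-> minors_ideal x y p.+2 f.
Proof.
split; last exact: theta_minors_toric.
rewrite /toric_ideal toric_mapE => f0.
apply: (monomial_map_ker _ _ _ theta_fiber f0).
- exact: minors_ideal0.
- exact: minors_idealD.
by move=> c g Ig; rewrite -mul_mpolyC; apply: minors_idealM.
Qed.

Lemma cmnm_deg s j : (j < p.+2)%N ->
  mdeg (cmnm s j) = (if j == p.+1 then a.+1 else 1%N).
Proof.
move=> jp; rewrite mdegE (sum_edges theta_no_loop).
rewrite (eq_bigr (fun c => (arc_col c == j) : nat)); last first.
  by move=> c _; rewrite !cmnm_edge; case: s; rewrite andbT andbF ?addn0.
rewrite big_sumType /= sum_nat_const card_ord (sum_ord_eq p.+1 true).
by case: eqP; case: eqP; lia.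
Qed.

Lemma theta_pdim_reg :
  is_pdim (@toric_ideal K theta_graph) p%:Z /\
  is_reg (@toric_ideal K theta_graph) (a.+2)%:Z.
Proof.
have [|ex0 exS] := @columns_exact K _ edge_col edge_side
   (fun j => edge (inr (inord j), true)) p.+1.
  move=> j i jp; rewrite -(half_ofK i) (can_eq (edge_ofK theta_no_loop)).
  case: (half i) => c b.
  rewrite /edge_col /edge_side (edge_ofK theta_no_loop) xpair_eqE eqb_id.
  congr (_ && _); case: c => [l|l]; first by rewrite gtn_eqF.
  by rewrite /= -[RHS]val_eqE /= inordK.
by apply: (en_pdim_reg theta_toricE _ _ ex0 exS) => j jp;
   rewrite dhomogX /= cmnm_deg.
Qed.

End Theta.

Theorem corollary4p6 (K : fieldType) (p r : int) (hp : 0 <= p) (hr : 2 <= r) :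
  exists G : sgraph,
    bipartite G /\
    is_pdim (@toric_ideal K G) p /\
    is_reg (@toric_ideal K G) r.
Proof.
case: p hp => // p _; case: r hr => // -[|[|r]] // _.
exists (theta_graph p r); split; first exact: subdiv_bipartite.
exact: theta_pdim_reg.
Qed.
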